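(* Let $G$ be a Hurwitz group of genus $17$, that is, a group of order $84\cdot(17-1)=1344$ generated by elements $x,y,z$ satisfying $x^3=y^2=z^7=xyz=1$. Then $G$ is a non-split extension of an elementary abelian group of order $8$ by $\mathrm{GL}_3(2)$: there is a normal subgroup $T\trianglelefteq G$ with $T\cong (\mathrm{C}_2)^3$ and $G/T\cong \mathrm{GL}_3(2)$, and $T$ has no complement in $G$ (there is no subgroup $C\le G$ with $C\cap T=1$ and $CT=G$). In particular, $G$ is not isomorphic to the affine group $\mathrm{AGL}_3(2)$.
   Context: A Hurwitz group of genus $g\ge 2$ is a finite group of order $84(g-1)$ that is a quotient of the triangle group $\Delta(3,2,7)=\langle X,Y,Z\mid X^3=Y^2=Z^7=XYZ=1\rangle$ (equivalently, a group of order $84(g-1)$ acting as the automorphism group of a compact Riemann surface of genus $g$). $\mathrm{C}_2$ is the cyclic group of order $2$; $\mathrm{GL}_3(2)$ is the group of invertible $3\times 3$ matrices over the field $\mathbb{F}_2$ (of order $168$); $\mathrm{AGL}_3(2)$ is the group of all affine transformations $v\mapsto Av+b$ of $\mathbb{F}_2^3$, with $A\in\mathrm{GL}_3(2)$ and $b\in\mathbb{F}_2^3$. *)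

(* Defs.v *)
From HB Require Import structures.
From mathcomp Require Import all_boot all_order all_fingroup all_algebra all_solvable.

Set Implicit Arguments.
Unset Strict Implicit.
Unset Printing Implicit Defensive.

Import GRing.Theory.
Local Open Scope group_scope.

(* The homg clause says that G is a quotient of the (infinite) triangle group *)
(* Delta(3,2,7); hurwitz_groupP unfolds it into generators and relations.     *)
Definition hurwitz_group (g : nat) (gT : finGroupType) (G : {group gT}) : bool :=
  [&& 1 < g, #|G| == 84 * (g - 1) &
      G \homg Grp (x : y : z : x ^+ 3, y ^+ 2, z ^+ 7, x * y * z)]%N.

Lemma hurwitz_groupP (g : nat) (gT : finGroupType) (G : {group gT}) :
  reflect [/\ (1 < g)%N, #|G| = (84 * (g - 1))%N &
              exists x y z : gT, [/\ <<[set x; y; z]>> = G, x ^+ 3 = 1,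
                y ^+ 2 = 1, z ^+ 7 = 1 & x * y * z = 1]]
          (hurwitz_group g G).
Proof.
have joinE (x y z : gT) : <[x]> <*> <[y]> <*> <[z]> = <<[set x; y; z]>>.
  by rewrite /cycle !joing_idr (joing_idl [set x]) joing_idl.
apply: (iffP and3P) => [[g_gt1 /eqP oG]|[g_gt1 oG]].
  case/existsP=> -[[x y] z] /= /eqP[defG x3 y2 z7 xyz]; split=> //.
  by exists x, y, z; split=> //; rewrite -joinE.
case=> x [y [z [defG x3 y2 z7 xyz]]]; split=> //; first exact/eqP.
by apply/existsP; exists (x, y, z); rewrite /= joinE defG x3 y2 z7 xyz.
Qed.

(* AGL_n(F) as a permutation group on F^n. Products of permutations compose   *)
(* left to right, so this is the opposite of the group of maps under usual    *)
(* composition, to which it is isomorphic through inversion.                  *)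
Definition AGLset (n : nat) (F : finFieldType) : {set {perm 'cV[F]_n}} :=
  [set s : {perm 'cV[F]_n} | [exists A : 'M[F]_n, exists b : 'cV[F]_n,
     (A \in unitmx) && [forall v, s v == (A *m v + b)%R]]].

Lemma AGLsetP (n : nat) (F : finFieldType) (s : {perm 'cV[F]_n}) :
  reflect (exists A : 'M[F]_n, exists2 b : 'cV[F]_n,
             A \in unitmx & forall v, s v = (A *m v + b)%R)
          (s \in AGLset n F).
Proof.
rewrite inE; apply: (iffP existsP) => [[A /existsP[b /andP[uA /forallP sE]]]|].
  by exists A, b => // v; apply/eqP.
case=> A [b uA sE]; exists A; apply/existsP; exists b; rewrite uA.
by apply/forallP=> v; rewrite sE.
Qed.

Lemma AGLset_group_set (n : nat) (F : finFieldType) : group_set (AGLset n F).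
Proof.
apply/group_setP; split=> [|s t].
  apply/AGLsetP; exists 1%:M%R, 0%R; first exact: unitmx1.
  by move=> v; rewrite perm1 mul1mx addr0.
case/AGLsetP=> A [b uA sE] /AGLsetP[B [c uB tE]].
apply/AGLsetP; exists (B *m A)%R, (B *m b + c)%R; first by rewrite unitmx_mul uB.
by move=> v; rewrite permM sE tE mulmxDr mulmxA addrA.
Qed.

Definition AGL (n : nat) (F : finFieldType) : {group {perm 'cV[F]_n}} :=
  Group (AGLset_group_set n F).

(* Main.v *)
Require Import Defs.
From mathcomp Require Import all_boot all_order all_fingroup all_algebra all_solvable.
From mathcomp Require Import mxrepresentation mxabelem.

Set Implicit Arguments.
Unset Strict Implicit.
Unset Printing Implicit Defensive.

(** A Hurwitz group is generated by y and z with y^2 = z^7 = (y z)^3 = 1.  As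
    2, 3 and 7 are pairwise coprime, a quotient in which y, z or y z dies is
    trivial, so a proper normal subgroup has index divisible by 42
    ([triangle_index]); moreover no group of order 42 or 84 has such
    generators, because its Sylow 7-subgroup would be normal.  For |G| = 1344
    it follows that a proper normal subgroup has order dividing 32, and order
    exactly 8 as soon as its order is at least 8.

    The remaining input is a classification of small transitive actions of the
    triangle group.  Such an action is a table of the permutations y and z, and
    a backtracking search over partial tables finds all tables of a given
    degree ([all_tables_sound] says that the search misses nothing).  Three
    degrees are used:
    - degree 8: the group induced has order at most 168 ([triangle_degree8]);
    - degree 21 with 2-groups as point stabilisers: likewise
      ([triangle_degree21]);
    - degree 16: there is no transitive action at all ([triangle_degree16]).

    Acting on the 21 cosets of a Sylow 2-subgroup, G has a kernel of order at
    least 8, hence exactly 8: this is T.  If z centralised T, then T would be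
    central; extending a subgroup of order 4 of T by a subgroup of order 21
    would give a subgroup of index 16, against the third fact
    ([normal8_not_cent]).  So z permutes the 7 nontrivial elements of T
    transitively, T is elementary abelian, and 'C_G(T) = T by the orders
    available for normal subgroups.  Hence G / T embeds in the group GL_3(2) of
    automorphisms of T, and both have order 168.

    If T had a complement C, then the action on the 8 cosets of C would have a
    kernel K of order at least 8 inside C; K is normal and meets T trivially,
    so K T would be a proper normal subgroup of order 64, which does not
    divide 32.  Finally AGL_3(2) acts faithfully on 8 points, so it is not a
    quotient of the triangle group by the first fact. *)

(** * Backtracking over partial action tables *)

Notation tab s := (nth 0 s).

(** [Unknown p] names a point whose image under y is needed but undetermined. *)
Inductive verdict := Inconsistent | Closed | Unknown of nat.

Section Search.

Variables (ls : seq nat) (n : nat) (ok : seq nat -> seq nat -> bool).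

(** Points are numbered from 0.  [Z] is the table of z, defined everywhere since
    points are added by whole cycles of z; [Y] is a partial table of y.  [trace]
    follows (y z)^k from p, and returns on the right the first point with unknown
    image. *)
Fixpoint trace (Y : seq (option nat)) (Z : seq nat) k p : nat + nat :=
  if k is k'.+1 then
    if nth None Y p is Some q then trace Y Z k' (tab Z q) else inr p
  else inl p.

(** Tests the relation (y z)^3 = 1 at each point of [ps]; a table is [Closed] only
    if y is defined at all of them. *)
Fixpoint scan (Y : seq (option nat)) (Z : seq nat) (ps : seq nat) : verdict :=
  if ps is p :: ps' then
    match trace Y Z 3 p with
    | inr q => Unknown q
    | inl q => if q == p then scan Y Z ps' else Inconsistent
    end
  else Closed.

Definition glue (Y : seq (option nat)) i j :=
  set_nth None (set_nth None Y i (Some j)) j (Some i).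

(** As y is an involution, y may send i to j only if y is unknown at j or already
    sends j to i. *)
Definition free_for (Y : seq (option nat)) i j :=
  if nth None Y j is Some k then k == i else true.

Definition add_cycle (Z : seq nat) l := Z ++ rcons (iota (size Z).+1 l.-1) (size Z).

(** Checks [ok] on every complete table on [n] points that extends the given one
    and in which the cycle lengths of z belong to [ls].  The image under y of the
    first point needed is either a known point or lies on a new cycle of z, and
    then it can be numbered as the first point of that cycle: each transitive
    action is met up to renumbering.  Exhausted fuel counts as failure, so its
    amount is irrelevant to soundness. *)
Fixpoint search fuel (Y : seq (option nat)) (Z : seq nat) : bool :=
  if fuel is k.+1 then
    match scan Y Z (iota 0 (size Z)) with
    | Inconsistent => true
    | Closed => if size Z == n then ok [seq odflt 0 o | o <- Y] Z else true
    | Unknown i =>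
        all (fun j => if free_for Y i j then search k (glue Y i j) Z else true)
            (iota 0 (size Z))
        && all (fun l => if size Z + l <= n then
                   search k (glue (Y ++ nseq l None) i (size Z)) (add_cycle Z l)
                 else true) ls
    end
  else false.

Definition all_tables_ok :=
  all (fun l => search n.+1 (nseq l None) (add_cycle [::] l)) ls.

End Search.

(** * Soundness of the search *)

Local Open Scope group_scope.

Lemma gen_ind (gT : finGroupType) (y z : gT) (P : gT -> Prop) :
  P 1 -> (forall g, P g -> P (g * y)) -> (forall g, P g -> P (g * z)) ->
  forall g, g \in <<[set y; z]>> -> P g.
Proof.
move=> P1 Py Pz g /gen_prodgP[m [c cyz ->]]; elim: m c cyz => [|m IHm] c cyz.
  by rewrite big_ord0.
rewrite big_ord_recr /=; have /set2P[] := cyz ord_max => ->; [apply: Py|apply: Pz].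
  by apply: IHm => i; apply: cyz.
by apply: IHm => i; apply: cyz.
Qed.

Section Soundness.

Variables (gT : finGroupType) (rT : finType) (to : {action gT &-> rT}).
Variables (S : {set rT}) (y z : gT).
Let G := <<[set y; z]>>%G.

(** [phi] numbers the points of [S], and [Y], [Z] are the tables of y and z in
    this numbering. *)
Definition labelling (phi : seq rT) (Y Z : seq nat) :=
  [/\ uniq phi, phi =i S, size Z = size phi &
      forall s i, i < size phi ->
        [/\ tab Y i < size phi, tab Z i < size phi,
            to (nth s phi i) y = nth s phi (tab Y i) &
            to (nth s phi i) z = nth s phi (tab Z i)]]%N.

Hypotheses (y2 : y ^+ 2 = 1) (yz3 : (y * z) ^+ 3 = 1).
Hypothesis trS : [transitive G, on S | to].
Variable ls : seq nat.
(* The cycle of z through s has length l + 1. *)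
Hypothesis lsP : forall s, s \in S ->
  exists2 l, l.+1 \in ls & uniq (traject (to^~ z) s l.+1) /\ iter l.+1 (to^~ z) s = s.

Variable s0 : rT.
Hypothesis Ss0 : s0 \in S.

(** The invariant of the search: [phi] numbers some points of [S], a set stable
    under z, and the tables are correct where they are defined. *)
Definition partial (phi : seq rT) (Y : seq (option nat)) (Z : seq nat) :=
  [/\ size Y = size phi, size Z = size phi, uniq phi /\ {subset phi <= S},
      forall i, i < size phi -> tab Z i < size phi /\
         to (nth s0 phi i) z = nth s0 phi (tab Z i) &
      forall i j, i < size phi -> nth None Y i = Some j ->
         j < size phi /\ to (nth s0 phi i) y = nth s0 phi j]%N.

Let Gy : y \in G. Proof. by rewrite mem_gen // set21. Qed.
Let Gz : z \in G. Proof. by rewrite mem_gen // set22. Qed.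

Lemma act_stable a s : a \in G -> s \in S -> to s a \in S.
Proof.
by move=> Ga Ss; have /subsetP/(_ a Ga)/astabs_act-> := atrans_acts trS.
Qed.

Lemma act_yy s : to (to s y) y = s.
Proof. by rewrite -actM -[y * y]/(y ^+ 2) y2 act1. Qed.

Lemma partial_set phi Y Z i j : partial phi Y Z -> (i < size phi)%N -> (j < size phi)%N ->
  to (nth s0 phi i) y = nth s0 phi j -> partial phi (set_nth None Y i (Some j)) Z.
Proof.
move=> [sY sZ uS mZ mY] ip jp yij; split=> //.
  by rewrite size_set_nth sY; apply/maxn_idPr.
move=> i' j' ip'; rewrite nth_set_nth /=; case: eqP => [-> [<-] //|_].
exact: mY.
Qed.

Lemma partial_glue phi Y Z i j : partial phi Y Z -> (i < size phi)%N -> (j < size phi)%N ->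
  to (nth s0 phi i) y = nth s0 phi j -> partial phi (glue Y i j) Z.
Proof.
move=> m ip jp yij; apply: partial_set => //; first exact: partial_set.
by rewrite -yij act_yy.
Qed.

Lemma partial_free phi Y Z i j : partial phi Y Z -> (i < size phi)%N -> (j < size phi)%N ->
  to (nth s0 phi i) y = nth s0 phi j -> free_for Y i j.
Proof.
move=> [sY sZ [u _] mZ mY] ip jp yij; rewrite /free_for; case Yj: nth => [k|//].
have [kp] := mY _ _ jp Yj; rewrite -yij act_yy => /esym/eqP.
by rewrite nth_uniq.
Qed.

(** A point outside the numbered ones is added together with its whole cycle
    under z, so that z stays defined everywhere. *)
Lemma partial_cycle phi Y Z p l : partial phi Y Z -> p \in S -> p \notin phi ->
  uniq (traject (to^~ z) p l.+1) -> iter l.+1 (to^~ z) p = p ->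
  partial (phi ++ traject (to^~ z) p l.+1) (Y ++ nseq l.+1 None) (add_cycle Z l.+1).
Proof.
move=> [sY sZ [u sub] mZ mY] Sp np ut itp.
have sT : size (traject (to^~ z) p l.+1) = l.+1 by rewrite size_traject.
have phiz q : q \in phi -> to q z \in phi.
  move=> /(nthP s0)[i ip <-]; have [jp ->] := mZ _ ip; exact: mem_nth.
split; first by rewrite !size_cat size_nseq sT sY.
- by rewrite !size_cat size_rcons size_iota sT sZ.
- split.
    rewrite cat_uniq u ut andbT andTb; apply/hasPn => q /trajectP[k kl ->].
    apply: contra np => /= kin.
    (* The known points are stable under z, so a point of the cycle of p among
       them would bring in p itself. *)
    rewrite -itp -(subnK (ltnW kl)) iterD.
    elim: (l.+1 - k)%N => [//|m IH]; exact: phiz.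
  move=> q; rewrite mem_cat => /orP[/sub //|/trajectP[k _ ->]].
  by elim: k => //= k IH; apply: act_stable => //; exact: Gz.
- move=> i; rewrite size_cat sT => ip; rewrite /add_cycle !nth_cat sZ.
  case: (ltnP i (size phi)) => [lip|gei].
    have [a ->] := mZ _ lip; rewrite a; split=> //.
    by rewrite ltn_addr.
  have ipl : (i - size phi < l.+1)%N by rewrite ltn_subLR // -addnS.
  have nT k : (k < l.+1)%N -> nth s0 (traject (to^~ z) p l.+1) k = iter k (to^~ z) p.
    by move=> kl; rewrite (set_nth_default p) ?sT // nth_traject.
  rewrite nT // -[to (iter _ _ _) z]/(iter _.+1 (to^~ z) p).
  move: ipl; rewrite nth_rcons size_iota ltnS leq_eqVlt => /orP[/eqP il|il].
    by rewrite il ltnn eqxx itp ltnn subnn -{1}[size phi]addn0 ltn_add2l.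
  rewrite il nth_iota // addSn subnKC //.
  have -> : (i.+1 < size phi)%N = false by rewrite ltnNge leqW.
  rewrite subSn // addnS ltnS -{1}(subnKC gei) ltn_add2l il; split=> //.
  by rewrite -[LHS]/(iter (i - size phi).+1 (to^~ z) p) -nT.
- move=> i j; rewrite size_cat => ip; rewrite !nth_cat sY.
  case: (ltnP i (size phi)) => [lip Yi|gei]; last by rewrite nth_nseq if_same.
  have [jp ->] := mY _ _ lip Yi; rewrite jp; split=> //; exact: ltn_addr.
Qed.

Lemma trace_sound phi Y Z k p : partial phi Y Z -> (p < size phi)%N ->
  match trace Y Z k p with
  | inl q => (q < size phi)%N /\ to (nth s0 phi p) ((y * z) ^+ k) = nth s0 phi q
  | inr q => (q < size phi)%N
  end.
Proof.
move=> m; elim: k p => [|k IHk] p pp /=; first by rewrite act1.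
have [sY sZ [u sub] mZ mY] := m.
case Yp: nth => [q|//]; have [qp yq] := mY _ _ pp Yp.
have [zp zq] := mZ _ qp; have := IHk _ zp; case: trace => // r [rp <-].
by rewrite expgS !actM yq zq.
Qed.

Local Arguments trace : simpl never.

Lemma scan_sound phi Y Z ps : partial phi Y Z -> all (fun p => p < size phi)%N ps ->
  match scan Y Z ps with
  | Inconsistent => False
  | Closed => forall p, p \in ps -> nth None Y p != None
  | Unknown q => (q < size phi)%N
  end.
Proof.
move=> m; elim: ps => [|p ps IHps] //= /andP[pp psp].
have := trace_sound 3 m pp; rewrite yz3 act1.
have Yp : forall q, trace Y Z 3 p = inl q -> nth None Y p != None.
  by move=> q; rewrite /trace; case: nth.
have [_ _ [u _] _ _] := m; case: (trace Y Z 3 p) Yp => [q|q] Yp // [qp /esym/eqP].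
have {}Yp := Yp _ erefl.
rewrite nth_uniq // => ->; have := IHps psp; case: scan => // YP r.
by rewrite inE => /predU1P[->//|/YP].
Qed.

(** A nonempty set stable under the generators is an orbit, so it is all of [S]. *)
Lemma closed_full (phi : seq rT) : (0 < size phi)%N -> {subset phi <= S} ->
  (forall p, p \in phi -> to p y \in phi) ->
  (forall p, p \in phi -> to p z \in phi) -> phi =i S.
Proof.
case: phi => // p phi _ sub cy cz q; apply/idP/idP; first exact: sub.
have Sp : p \in S by apply: sub; rewrite mem_head.
rewrite -(atransP trS _ Sp) => /orbitP[g Gg <-].
apply: (gen_ind (P := fun h => to p h \in p :: phi) _ _ _ Gg) => [|h|h].
- by rewrite act1 mem_head.
- by rewrite actM; apply: cy.
- by rewrite actM; apply: cz.
Qed.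

Variable ok : seq nat -> seq nat -> bool.

(** Of the alternatives tried by the search, one agrees with the actual action;
    following it ends in a complete table of that action. *)
Lemma search_sound fuel phi Y Z : search ls #|S| ok fuel Y Z ->
  partial phi Y Z -> (0 < size phi)%N ->
  exists phi' Y' Z', labelling phi' Y' Z' /\ ok Y' Z'.
Proof.
elim: fuel phi Y Z => //= k IHk phi Y Z srch m phi0.
have [sY sZ [u sub] mZ mY] := m.
have := @scan_sound phi Y Z (iota 0 (size Z)) m.
have -> : all (fun p => p < size phi)%N (iota 0 (size Z)).
  by apply/allP => p; rewrite mem_iota sZ.
move=> /(_ isT); case: scan srch => [//|srch cl|i /andP[srch1 srch2] ip].
  have mY' i : (i < size phi)%N -> exists2 j, nth None Y i = Some j &
      (j < size phi)%N /\ to (nth s0 phi i) y = nth s0 phi j.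
    move=> ip; have := cl i; rewrite mem_iota sZ => /(_ ip).
    by case Yi: nth => [j|//] _; exists j => //; exact: mY.
  have full : phi =i S.
    apply: closed_full => // p /(nthP s0)[i ip <-].
      by have [j _ [jp ->]] := mY' _ ip; exact: mem_nth.
    by have [jp ->] := mZ _ ip; exact: mem_nth.
  move: srch; rewrite sZ -(card_uniqP u) (eq_card full) eqxx => okYZ.
  exists phi, [seq odflt 0%N o | o <- Y], Z; split=> //; split=> // s i ip.
  have [j Yi [jp yij]] := mY' _ ip; have [kp zij] := mZ _ ip.
  rewrite (nth_map None) ?sY // Yi kp; split=> //=;
    by rewrite !(set_nth_default s0 s) ?yij ?zij.
have Sp : nth s0 phi i \in S by apply/sub/mem_nth.
have Syp := act_stable Gy Sp.
case: (boolP (to (nth s0 phi i) y \in phi)) => [/(nthP s0)[j jp /esym yij]|nin].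
  apply: (IHk phi (glue Y i j) Z) => //; last exact: partial_glue.
  have := allP srch1 j; rewrite mem_iota sZ => /(_ jp).
  by rewrite (partial_free m ip jp yij).
have [l lls [ut itp]] := lsP Syp.
have mc := partial_cycle m Syp nin ut itp.
set phi' := phi ++ _ in mc.
have sphi' : size phi' = (size phi + l.+1)%N by rewrite size_cat size_traject.
apply: (IHk phi' (glue (Y ++ nseq l.+1 None) i (size Z)) (add_cycle Z l.+1)); last first.
- by rewrite sphi' addnS.
- apply: partial_glue; rewrite // ?sphi' ?sZ.
  + exact: ltn_addr.
  + by rewrite addnS ltnS leq_addr.
  + by rewrite !nth_cat ip ltnn subnn.
have := allP srch2 _ lls; rewrite sZ -sphi'.
have [_ _ [u' sub'] _ _] := mc.
suff -> : (size phi' <= #|S|)%N by [].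
by rewrite -(card_uniqP u'); apply/subset_leq_card/subsetP.
Qed.

(** If the search succeeds, the action of y and z on [S] has, in a suitable
    numbering, a table that satisfies [ok]. *)
Lemma all_tables_sound : all_tables_ok ls #|S| ok ->
  exists phi Y Z, labelling phi Y Z /\ ok Y Z.
Proof.
move=> ts; have [l lls [ut itp]] := lsP Ss0.
apply: (search_sound (allP ts _ lls) (phi := traject (to^~ z) s0 l.+1)) => //.
have m0 : partial [::] [::] [::] by split.
exact: (partial_cycle m0 Ss0 isT ut itp).
Qed.

End Soundness.

(** * Permutation groups read off from tables *)

Local Close Scope group_scope.

(** A row lists the images of the points; [rowmul s r] is the row of g h if [r]
    is the row of g and [s] the table of h. *)
Definition rowmul (s r : seq nat) := [seq tab s i | i <- r].

(** Enumerates rows reachable by right multiplication by y and z; whether the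
    enumeration is complete is decided afterwards, in [order_le168], by testing
    the list for closure. *)
Fixpoint saturate fuel (Y Z : seq nat) (seen todo : seq (seq nat)) :=
  if fuel is k.+1 then
    if todo is r :: todo' then
      let new := undup [seq q <- [:: rowmul Y r; rowmul Z r] | q \notin seen] in
      saturate k Y Z (new ++ seen) (new ++ todo')
    else seen
  else seen.

Definition order_le168 (Y Z : seq nat) :=
  let id := iota 0 (size Z) in
  let R := saturate 169 Y Z [:: id] [:: id] in
  [&& size R <= 168, id \in R &
     all (fun r => (rowmul Y r \in R) && (rowmul Z r \in R)) R].

Definition walk (Y Z : seq nat) (w : seq bool) i :=
  foldl (fun i (b : bool) => tab (if b then Y else Z) i) i w.

(** The word (y z^3)^2, with [true] for y and [false] for z.  Among the tables of
    degree 21 it tells the action of GL_3(2) on its 21 flags from the others, in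
    which it fixes a point without having order a power of 2. *)
Definition yz3yz3 := [:: true; false; false; false; true; false; false; false].

(** A necessary condition for the point stabilisers to have exponent dividing
    64. *)
Definition stab2_test (Y Z : seq nat) :=
  let f := walk Y Z yz3yz3 in
  let ps := iota 0 (size Z) in
  if has (fun i => f i == i) ps then all (fun i => iter 64 f i == i) ps else true.

Definition ok21 (Y Z : seq nat) :=
  if stab2_test Y Z then order_le168 Y Z else true.

Lemma all_tables_ok8 : all_tables_ok [:: 1; 7] 8 order_le168.
Proof. by vm_cast_no_check (erefl true). Qed.

Lemma all_tables_ok16 : all_tables_ok [:: 1; 7] 16 (fun _ _ => false).
Proof. by vm_cast_no_check (erefl true). Qed.

Lemma all_tables_ok21 : all_tables_ok [:: 7] 21 ok21.
Proof. by vm_cast_no_check (erefl true). Qed.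

Local Open Scope group_scope.

Section ReadingTables.

Variables (gT : finGroupType) (rT : finType) (to : {action gT &-> rT}).
Variables (S : {set rT}) (y z : gT).
Let G := <<[set y; z]>>%G.
Variables (phi : seq rT) (Y Z : seq nat).
Hypothesis lab : labelling to S y z phi Y Z.

Lemma index_table : {in phi, forall q, index (to q y) phi = tab Y (index q phi)} /\
                    {in phi, forall q, index (to q z) phi = tab Z (index q phi)}.
Proof.
have [u phiS _ step] := lab.
by split=> q qin; have ip := qin; rewrite -index_mem in ip;
  have [yp zp ey ez] := step q _ ip; rewrite -{1}(nth_index q qin) ?ey ?ez index_uniq.
Qed.

(** Elements of G inducing different permutations have different rows, and all
    rows lie in a list, closed under the generators, of at most 168 rows. *)
Lemma order_le168_sound : order_le168 Y Z ->
  [transitive G, on S | to] -> (#|G : 'C_G(S | to)| <= 168)%N.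
Proof.
rewrite /order_le168; move: (saturate _ _ _ _ _) => R /and3P[R168 R1 /allP Rcl] trS.
have [u phiS sZ _] := lab; rewrite sZ in R1; have [idxY idxZ] := index_table.
pose row g := [seq index (to s g) phi | s <- phi].
have stab g : g \in G -> {in phi, forall s, to s g \in phi}.
  move=> Gg s; rewrite !phiS => Ss.
  by have /subsetP/(_ g Gg)/astabs_act-> := atrans_acts trS.
have rowP g : g \in G -> row g \in R.
  move=> Gg; have: g \in G /\ row g \in R; last by case.
  apply: (gen_ind (P := fun g => g \in G /\ row g \in R)) Gg => [|h [Gh Rh]|h [Gh Rh]].
  - split=> //; rewrite (_ : row 1 = iota 0 (size phi)) //.
    apply: (@eq_from_nth _ 0%N); first by rewrite size_map size_iota.
    rewrite size_map => i ip; have [s _] : exists s, s \in phi.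
      by case: (phi) ip => // s p _; exists s; rewrite mem_head.
    by rewrite (nth_map s) // act1 index_uniq // nth_iota.
  - split; first by rewrite groupM // mem_gen // set21.
    rewrite (_ : row _ = rowmul Y (row h)); first by have /andP[] := Rcl _ Rh.
    by rewrite /rowmul -map_comp; apply/eq_in_map => s sp /=; rewrite actM idxY // stab.
  - split; first by rewrite groupM // mem_gen // set22.
    rewrite (_ : row _ = rowmul Z (row h)); first by have /andP[] := Rcl _ Rh.
    by rewrite /rowmul -map_comp; apply/eq_in_map => s sp /=; rewrite actM idxZ // stab.
pose f (A : {set gT}) := row (repr A).
have cosetP A : A \in rcosets 'C_G(S | to) G -> repr A \in G /\ A = 'C_G(S | to) :* repr A.
  case/rcosetsP=> g Gg ->; split; last by rewrite rcoset_repr.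
  have: repr ('C_G(S | to) :* g) \in G :* g.
    exact: (subsetP (mulSg _ (subsetIl _ _)) _ (mem_repr_rcoset _ _)).
  by rewrite rcoset_id.
have finj : {in rcosets 'C_G(S | to) G &, injective f}.
  move=> A B /cosetP[GA eA] /cosetP[GB eB]; rewrite /f /row => /eq_in_map ef.
  rewrite eA eB; apply/rcoset_eqP; rewrite mem_rcoset !inE groupM ?groupV //=.
  apply/subsetP=> s; rewrite inE -phiS => sp.
  have {}e : to s (repr A) = to s (repr B).
    by rewrite -(nth_index s (stab _ GA _ sp)) (ef s sp) nth_index // stab.
  by rewrite actM e -actM mulgV act1.
apply: leq_trans R168; rewrite /indexg cardE -(size_map f).
apply: uniq_leq_size.
  rewrite map_inj_in_uniq ?enum_uniq // => A B.
  by rewrite !mem_enum; apply: finj.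
by move=> r /mapP[A]; rewrite mem_enum => /cosetP[GA _] ->; apply: rowP.
Qed.

Lemma walk_sound w s i : (i < size phi)%N ->
  (walk Y Z w i < size phi)%N /\
  to (nth s phi i) (\prod_(b <- w) (if b then y else z)) = nth s phi (walk Y Z w i).
Proof.
have [_ _ _ step] := lab.
elim: w i => [|b w IHw] i ip; first by rewrite big_nil act1.
rewrite big_cons actM; have [yp zp ey ez] := step s _ ip.
by case: b => /=; rewrite ?ey ?ez; apply: IHw.
Qed.

Lemma stab2_test_sound :
  (forall g s, g \in G -> s \in S -> to s g = s -> g ^+ 64 = 1) -> stab2_test Y Z.
Proof.
(* With a variable in place of 64 the iterations are never unfolded. *)
rewrite /stab2_test; move: 64 => N st2; have [u phiS -> _] := lab.
set f := walk Y Z yz3yz3; pose w := \prod_(b <- yz3yz3) (if b then y else z).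
have Gw : w \in G by apply: group_prod => b _; case: b; rewrite mem_gen // ?set21 ?set22.
have fP s i : (i < size phi)%N -> (f i < size phi)%N /\ to (nth s phi i) w = nth s phi (f i).
  exact: walk_sound.
case: hasP => // -[i]; rewrite mem_iota /= => ip /eqP fi.
have [s _] : exists s, s \in phi.
  by case: (phi) ip => // s p _; exists s; rewrite mem_head.
have wN : w ^+ N = 1.
  by apply: (st2 _ (nth s phi i)); rewrite // -?phiS ?mem_nth // (fP s i ip).2 fi.
apply/allP=> j; rewrite mem_iota /= => jp; have {jp} jp : (j < size phi)%N by [].
have powP k : (iter k f j < size phi)%N /\ to (nth s phi j) (w ^+ k) = nth s phi (iter k f j).
  elim: k => [|k [kp ek]]; first by rewrite act1.
  by rewrite iterS expgSr actM ek; apply: fP.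
have [kp] := powP N; rewrite wN act1 => /esym/eqP.
by rewrite nth_uniq.
Qed.

End ReadingTables.

(** * Normal subgroups of quotients of the triangle group *)

(** The relations of the triangle group, with the generator x = (y z)^-1
    eliminated. *)
Definition triangle_gens (gT : finGroupType) (G : {set gT}) (y z : gT) :=
  [/\ <<[set y; z]>> = G, y ^+ 2 = 1, z ^+ 7 = 1 & (y * z) ^+ 3 = 1].

(** If one of the three elements of coprime orders 2, 3, 7 and product 1 is
    trivial, the other two are inverse to each other, hence trivial. *)
Lemma triangle_trivial (gT : finGroupType) (G : {group gT}) (y z : gT) :
  triangle_gens G y z -> [|| y == 1, y * z == 1 | z == 1] -> G :=: 1.
Proof.
case=> <- y2 z7 yz3 triv.
suff [-> ->] : y = 1 /\ z = 1 by rewrite setUid; apply: cycle1.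
case/or3P: triv => /eqP e; last 1 first.
- split=> //; rewrite e mulg1 in yz3.
  by rewrite -yz3 (expgS y 2) y2 mulg1.
- split=> //; rewrite e mul1g in yz3.
  by rewrite -z7 (expgS z 6) (expgM z 3 2) yz3 expg1n mulg1.
have ez : z = y by rewrite -[z]mul1g -y2 -mulgA e mulg1.
suff: y = 1 by rewrite ez.
by rewrite -z7 ez (expgS y 6) (expgM y 2 3) y2 expg1n mulg1.
Qed.

Lemma triangle_order (gT : finGroupType) (G : {group gT}) (y z : gT) :
  triangle_gens G y z -> G :!=: 1 -> 42 %| #|G|.
Proof.
move=> triG ntG; have [defG y2 z7 yz3] := triG.
have Gy : y \in G by rewrite -defG mem_gen // set21.
have Gz : z \in G by rewrite -defG mem_gen // set22.
have pr_order p a : prime p -> a \in G -> a ^+ p = 1 -> a != 1 -> p %| #|G|.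
  by move=> pr_p Ga ap1 nt_a; rewrite -(nt_prime_order pr_p ap1 nt_a) order_dvdG.
have [y1 | nt_y] := eqVneq y 1.
  by case/eqP: ntG; apply: triangle_trivial triG _; rewrite y1 eqxx.
have [yz1 | nt_yz] := eqVneq (y * z) 1.
  by case/eqP: ntG; apply: triangle_trivial triG _; rewrite yz1 eqxx orbT.
have [z1 | nt_z] := eqVneq z 1.
  by case/eqP: ntG; apply: triangle_trivial triG _; rewrite z1 eqxx !orbT.
rewrite -[42]/(2 * 3 * 7)%N !Gauss_dvd //.
by rewrite (pr_order 2 y) // (pr_order 3 (y * z)) ?groupM // (pr_order 7 z).
Qed.

Lemma triangle_quotient (gT : finGroupType) (G N : {group gT}) (y z : gT) :
  triangle_gens G y z -> N <| G -> triangle_gens (G / N) (coset N y) (coset N z).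
Proof.
case=> defG y2 z7 yz3 /andP[_ nNG].
have nNy : y \in 'N(N) by rewrite (subsetP nNG) // -defG mem_gen // set21.
have nNz : z \in 'N(N) by rewrite (subsetP nNG) // -defG mem_gen // set22.
split; last by rewrite -morphM // -morphX ?groupM // yz3 morph1.
- rewrite -defG quotient_gen ?subUset ?sub1set ?nNy //.
  by rewrite /quotient morphimU !morphim_set1.
- by rewrite -morphX // y2 morph1.
- by rewrite -morphX // z7 morph1.
Qed.

Lemma triangle_index (gT : finGroupType) (G N : {group gT}) (y z : gT) :
  triangle_gens G y z -> N <| G -> N :!=: G -> 42 %| #|G : N|.
Proof.
move=> triG nNG neNG; have [sNG nN] := andP nNG.
rewrite -card_quotient //; apply: triangle_order (triangle_quotient triG nNG) _.
apply: contra neNG => /eqP/trivgP q1; rewrite eqEsubset sNG.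
by rewrite -quotient_sub1.
Qed.

(** A normal Sylow 7-subgroup would have index prime to 7, against
    [triangle_index]. *)
Lemma triangle_Syl7 (gT : finGroupType) (G : {group gT}) (y z : gT) :
  triangle_gens G y z -> G :!=: 1 -> #|'Syl_7(G)| != 1%N.
Proof.
move=> triG ntG; apply/negP => /cards1P[P0 defSyl].
have [P sylP] := Sylow_exists 7 G.
have Psyl Q : Q \in 'Syl_7(G) -> Q = P.
  have : P \in 'Syl_7(G) by rewrite inE.
  by rewrite defSyl !inE => /eqP-> /eqP->.
have nPG : P <| G.
  rewrite /normal (pHall_sub sylP); apply/subsetP=> g Gg; rewrite inE.
  by rewrite -{2}(Psyl (P :^ g)%G) //= inE pHallJ.
have d42 := triangle_order triG ntG.
have neP : P :!=: G.
  apply: contraL d42 => /eqP <-; apply/negP => /(dvdn_trans (isT : 2 %| 42)).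
  by rewrite (card_Hall sylP) p_part Euclid_dvdX.
have := dvdn_trans (isT : 7 %| 42) (triangle_index triG nPG neP).
by have /and3P[_ _] := sylP; rewrite p'natE // => /negP n7 /n7.
Qed.

(** The only divisor of 84 congruent to 1 modulo 7 is 1, so the Sylow 7-subgroup
    would be normal. *)
Lemma triangle_order_neq (gT : finGroupType) (G : {group gT}) (y z : gT) :
  triangle_gens G y z -> #|G| \notin [:: 42; 84]%N.
Proof.
move=> triG; apply/negP => oG.
have G1 : G :!=: 1 by rewrite -cardG_gt1; move: oG; rewrite !inE => /orP[]/eqP->.
have := triangle_Syl7 triG G1.
have := card_Syl_mod G (isT : prime 7).
have : #|'Syl_7(G)| %| 84.
  by apply: dvdn_trans (card_Syl_dvd 7 G) _; move: oG; rewrite !inE => /orP[]/eqP->.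
rewrite dvdn_divisors // -[divisors 84]/[:: 1; 2; 3; 4; 6; 7; 12; 14; 21; 28; 42; 84]%N.
by rewrite !inE => /or4P[|||/or4P[|||/or4P[|||/or3P[]]]] /eqP->.
Qed.

(** * Transitive actions of degree 8, 16 and 21 *)

Section Actions.

Variables (gT : finGroupType) (G : {group gT}) (y z : gT).
Hypothesis triG : triangle_gens G y z.
Variables (rT : finType) (to : {action gT &-> rT}) (S : {set rT}).
Hypothesis trS : [transitive G, on S | to].

(** Since z^7 = 1 with 7 prime, a cycle of z has length 1 or 7. *)
Lemma z_orbit s (l := if to s z == s then 0 else 6) :
  uniq (traject (to^~ z) s l.+1) /\ iter l.+1 (to^~ z) s = s.
Proof.
have [_ _ z7 _] := triG.
have itE k : iter k (to^~ z) s = to s (z ^+ k).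
  by elim: k => [|k IH]; rewrite ?act1 // iterS IH expgSr actM.
rewrite /l; case: eqP => [//|/eqP nfz]; split; last by rewrite itE z7 act1.
have key i j : (i < j < 7)%N -> to s (z ^+ i) != to s (z ^+ j).
  case/andP=> ij j7; apply: contra nfz => /eqP e.
  have fd : z ^+ (j - i) \in 'C[s | to].
    apply/astab1P; apply: (act_inj to (z ^+ i)).
    by rewrite -actM -expgD subnK ?(ltnW ij).
  have d_gt0 : (0 < j - i)%N by rewrite subn_gt0.
  have co : coprime #[z] (j - i).
    apply: coprime_dvdl (_ : #[z] %| 7) _; first by rewrite order_dvdn z7.
    rewrite prime_coprime // gtnNdvd //; exact: leq_ltn_trans (leq_subr _ _) j7.
  apply/eqP/astab1P.
  have: z \in <[z]> := cycle_id z.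
  rewrite -generator_coprime in co; rewrite (eqP co); apply: subsetP.
  by rewrite cycle_subG.
apply/(uniqP s) => i j; rewrite !inE !size_traject => i7 j7.
rewrite !nth_traject // !itE => e; case: (ltngtP i j) => // ij.
  by have := key i j; rewrite ij j7 e eqxx => /(_ isT).
by have := key j i; rewrite ij i7 e eqxx => /(_ isT).
Qed.

Lemma triangle_labelling ls ok : all_tables_ok ls #|S| ok ->
  (forall s, s \in S -> (if to s z == s then 1 else 7)%N \in ls) ->
  exists phi Y Z, labelling to S y z phi Y Z /\ ok Y Z.
Proof.
move=> tabs lsP; have [defG y2 _ yz3] := triG.
have trS' : [transitive <<[set y; z]>>%G, on S | to] by rewrite /= defG.
have /imsetP[s Ss _] := trS.
apply: (all_tables_sound y2 yz3 trS' _ Ss tabs) => t St.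
exists (if to t z == t then 0 else 6)%N; last exact: z_orbit.
by have := lsP t St; case: ifP.
Qed.

Lemma triangle_degree8 : #|S| = 8 -> #|G : 'C_G(S | to)| <= 168.
Proof.
move=> S8; have [defG _ _ _] := triG.
have: all_tables_ok [:: 1; 7]%N #|S| order_le168.
  by rewrite S8; apply: all_tables_ok8.
move=> /triangle_labelling[].
  by move=> s _; case: ifP.
move=> phi [Y [Z [lab ok]]]; have := order_le168_sound lab ok.
by rewrite /= defG; apply.
Qed.

Lemma triangle_degree16 : #|S| <> 16.
Proof.
move=> S16; have: all_tables_ok [:: 1; 7]%N #|S| (fun _ _ => false).
  by rewrite S16; apply: all_tables_ok16.
move=> /triangle_labelling[].
  by move=> s _; case: ifP.
by move=> phi [Y [Z []]].
Qed.

Lemma triangle_degree21 : #|S| = 21 ->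
  (forall g s, g \in G -> s \in S -> to s g = s -> g ^+ 64 = 1) ->
  #|G : 'C_G(S | to)| <= 168.
Proof.
move=> S21 st2; have [defG _ z7 _] := triG.
have: all_tables_ok [:: 7]%N #|S| ok21 by rewrite S21; apply: all_tables_ok21.
move=> /triangle_labelling[].
  (* A fixed point of z would give z^64 = 1, hence z = 1 and G trivial. *)
  move=> s Ss; case: eqP => // fz; have z1 : z = 1.
    have Gz : z \in G by rewrite -defG mem_gen // set22.
    by rewrite -(st2 z s Gz Ss fz) (expgS z 63) (expgM z 7 9) z7 expg1n mulg1.
  by have := atrans_dvd trS; rewrite S21 (triangle_trivial triG) ?z1 ?eqxx ?orbT // cards1.
move=> phi [Y [Z [lab]]]; rewrite /ok21 (stab2_test_sound lab); last first.
  by rewrite /= defG.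
by move=> /(order_le168_sound lab); rewrite /= defG; apply.
Qed.

End Actions.

(** * The normal subgroup of order 8 *)

Lemma abelem_Z2cube : 2.-abelem [set: 'Z_2 * 'Z_2 * 'Z_2].
Proof.
apply/abelemP=> //; split.
  apply/centsP=> [[[a b] c] _ [[a' b'] c'] _]; congr (_, _, _); exact: Zp_mulgC.
by case=> [[a b] c] _; move: a b c => [[|[|//]] ?] [[|[|//]] ?] [[|[|//]] ?]; apply/eqP.
Qed.

Lemma card_GL32 : #|'GL_3(2)| = 168.
Proof.
by rewrite card_GL // card_Fp // big_nat_recr //= big_nat_recr //= big_nat1.
Qed.

(** The dimension n.+1 is kept variable because that of an elementary abelian
    group is only provably equal to 3. *)
Lemma faithful_quotient_GL32 (gT : finGroupType) (G K : {group gT}) n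
    (rG : mx_representation 'F_2 G n.+1) :
  n = 2 -> rker rG = K -> #|G / K| = 168 -> G / K \isog 'GL_3(2).
Proof.
move=> n2; case: _ / (esym n2) rG => rG kerK oGK.
have f_isog := first_isog (reprGLm rG); rewrite ker_reprGLm kerK in f_isog.
suff <- : reprGLm rG @* G = 'GL_3(2) by [].
apply/eqP; rewrite eqEcard subsetT card_GL32 -(card_isog f_isog) oGK.
by [].
Qed.

Section Order1344.

Variables (gT : finGroupType) (G : {group gT}) (y z : gT).
Hypotheses (triG : triangle_gens G y z) (oG : #|G| = 1344).

Lemma gen_z : z \in G.
Proof. by case: triG => <- *; rewrite mem_gen // set22. Qed.

Lemma hurwitz17_neq1 : G :!=: 1. Proof. by rewrite -cardG_gt1 oG. Qed.

Lemma order_z : #[z] = 7.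
Proof.
have [_ _ z7 _] := triG; apply: nt_prime_order => //.
apply: contra hurwitz17_neq1 => /eqP z1; apply/eqP/(triangle_trivial triG).
by rewrite z1 eqxx !orbT.
Qed.

(** 1344 = 32 * 42, and 42 divides the index. *)
Lemma proper_normal_dvd32 (N : {group gT}) : N <| G -> N :!=: G -> #|N| %| 32.
Proof.
move=> nN neN; have [k ik] := dvdnP (triangle_index triG nN neN).
have := Lagrange (normal_sub nN); rewrite oG ik mulnA => /eqP.
rewrite -[1344]/(32 * 42)%N eqn_pmul2r // => /eqP <-; exact: dvdn_mulr.
Qed.

(** The other candidates 16 and 32 would leave a quotient of order 84 or 42. *)
Lemma proper_normal_eq8 (N : {group gT}) :
  N <| G -> N :!=: G -> (8 <= #|N|)%N -> #|N| = 8.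
Proof.
move=> nN neN N8; have := triangle_order_neq (triangle_quotient triG nN).
rewrite card_quotient ?normal_norm // -divgS ?normal_sub // oG.
move: N8.
have := proper_normal_dvd32 nN neN; rewrite dvdn_divisors //.
rewrite -[divisors 32]/[:: 1; 2; 4; 8; 16; 32]%N.
rewrite [_ \in [:: 1; _; _; _; _; _]%N]inE !in_cons in_nil orbF.
by do 5?[case/orP=> [/eqP-> //|]] => /eqP->.
Qed.

Lemma normal_contains_z (N : {group gT}) : N <| G -> z \in N -> N :=: G.
Proof.
move=> nN Nz; apply/eqP; apply/idPn => neN.
have := dvdn_trans (order_dvdG Nz) (proper_normal_dvd32 nN neN).
by rewrite order_z.
Qed.

Lemma gcore_ge8 (H : {group gT}) :
  (#|G : 'C_G(rcosets H G | 'Rs)| <= 168)%N -> H \subset G -> (8 <= #|gcore H G|)%N.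
Proof.
move=> i168 sHG; have nK := gcore_normal sHG.
rewrite astabRs_rcosets (setIidPr (normal_sub nK)) in i168.
have := Lagrange (normal_sub nK); rewrite oG => e.
rewrite leqNgt; apply/negP => K7.
have : (#|gcore H G| * #|G : gcore H G| <= 7 * 168)%N by apply: leq_mul.
by rewrite e.
Qed.

Lemma index8_gcore (H : {group gT}) : H \subset G -> #|G : H| = 8 ->
  (8 <= #|gcore H G|)%N.
Proof.
move=> sHG iH; apply: gcore_ge8 => //.
exact: (triangle_degree8 triG (transRs_rcosets H G) iH).
Qed.

(** The kernel of the action on the cosets of a Sylow 2-subgroup; point stabilisers
    are conjugate to that subgroup, of order 64. *)
Lemma exists_normal8 : exists2 T : {group gT}, T <| G & #|T| = 8.
Proof.
have [Q sylQ] := Sylow_exists 2 G; have sQG := pHall_sub sylQ.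
have oQ : #|Q| = 64 by rewrite (card_Hall sylQ) oG p_part.
have iQ : #|G : Q| = 21 by rewrite -divgS // oG oQ.
exists [group of gcore Q G]; rewrite /= ?gcore_normal //.
apply: proper_normal_eq8; rewrite /= ?gcore_normal //.
  apply: contraTneq (gcore_sub Q G) => /= ->; apply/negP => /subset_leq_card.
  by rewrite oG oQ.
apply: gcore_ge8 => //; apply: (triangle_degree21 triG (transRs_rcosets Q G) iQ).
move=> g s Gg /rcosetsP[h Gh ->] /= e.
have : h * g * h^-1 \in Q.
  have : h * g \in (Q :* h) :* g by rewrite mem_rcoset mulgK rcoset_refl.
  by rewrite -rcosetE e mem_rcoset.
move=> Qg; have := expg_cardG Qg; rewrite oQ.
rewrite -{1}[h]invgK -mulgA -/(conjg g h^-1) -conjXg => /eqP.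
by rewrite conjg_eq1 => /eqP.
Qed.

Variable T : {group gT}.
Hypotheses (nTG : T <| G) (oT : #|T| = 8).

Let sTG := normal_sub nTG.
Let nT := normal_norm nTG.

Lemma oGT : #|G / T| = 168.
Proof. by rewrite card_quotient // -divgS // oG oT. Qed.

(** Otherwise T is central.  The normaliser of a Sylow 7-subgroup of G / T has
    order 21 and lifts to a subgroup K of order 21 by Schur-Zassenhaus; together
    with a central subgroup of order 4 it generates a subgroup of index 16. *)
Lemma normal8_not_cent : z \notin 'C(T).
Proof.
apply/negP => cTz.
have cG : G \subset 'C(T).
  have nC : 'C_G(T) <| G by rewrite norm_normalI // norms_cent.
  by rewrite -(normal_contains_z nC) ?subsetIr // inE gen_z.
have triGT := triangle_quotient triG nTG.
have [P sylP] := Sylow_exists 7 (G / T).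
have oN : #|'N_(G / T)(P)| = 21.
  have ntGT : G / T != 1 by rewrite -cardG_gt1 oGT.
  have iN := card_Syl sylP.
  have := triangle_Syl7 triGT ntGT; have := card_Syl_mod (G / T)%G (isT : prime 7).
  have := card_Syl_dvd 7 (G / T); rewrite oGT iN => d m n1.
  have i8 : #|G / T : 'N_(G / T)(P)| = 8%N.
    move: d m n1; rewrite dvdn_divisors //.
    rewrite -[divisors 168]/[:: 1; 2; 3; 4; 6; 7; 8; 12; 14;
                               21; 24; 28; 42; 56; 84; 168]%N !inE.
    by do 15?[case/orP=> [/eqP-> //|]] => /eqP->.
  have := Lagrange (subsetIl (G / T) 'N(P)); rewrite oGT i8 -[168]/(21 * 8)%N => /eqP.
  by rewrite eqn_pmul2r // => /eqP.
have [N defN sTN sNG] := inv_quotientS nTG (subsetIl (G / T) 'N(P)).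
have nTN : T <| N := normalS sTN sNG nTG.
have oNT : #|N| = 168.
  by rewrite -(Lagrange sTN) oT -card_quotient ?normal_norm // -defN oN.
have hallT : Hall N T by rewrite /Hall sTN -divgS // oNT oT.
have /splitsP[K /complP[tiTK defTK]] := SchurZassenhaus_split hallT nTN.
have oK : #|K| = 21.
  have := TI_cardMg tiTK; rewrite defTK oNT oT -[168]/(8 * 21)%N => /eqP.
  by rewrite eqn_pmul2l // => /eqP.
have pT : 2.-group T by rewrite /pgroup oT.
have l2 : (2 <= logn 2 #|T|)%N by rewrite oT.
have [T0 [sT0 _ oT0]] := normal_pgroup pT (normal_refl T) l2.
have sKG : K \subset G by rewrite (subset_trans _ sNG) // -defTK mulG_subr.
have cT0K : K \subset 'C(T0) by rewrite (subset_trans sKG) // (subset_trans cG) // centS.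
have oH : #|T0 <*> K| = 84.
  rewrite cent_joinEr // TI_cardMg ?oT0 ?oK //.
  by apply/trivgP; rewrite -tiTK setSI.
have sHG : T0 <*> K \subset G by rewrite join_subG (subset_trans sT0).
apply: (triangle_degree16 triG (transRs_rcosets (T0 <*> K)%G G)).
by rewrite -[#|_|]/(#|G : _|) -divgS // oG /= oH.
Qed.

(** The orbits of the group of order 7 generated by z have length 1 or 7. *)
Lemma card_cent1_mod7 (N : {group gT}) : z \in 'N(N) -> #|N| = #|'C_N[z]| %[mod 7].
Proof.
move=> nNz; have p7 : 7.-group <[z]> by rewrite /pgroup -orderE order_z.
have := @pgroup_fix_mod _ _ _ 'J%act 7 <[z]>%G N p7; rewrite afixJ cent_cycle; apply.
by rewrite astabsJ cycle_subG.
Qed.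

(** As |T| = 8 and z does not centralise T, z centralises only the identity of T.
    The Frattini subgroup is therefore, being stable under z, of order 1 modulo
    7; it is proper, so it is trivial. *)
Lemma normal8_abelem : 2.-abelem T.
Proof.
have pT : 2.-group T by rewrite /pgroup oT.
have nTz : z \in 'N(T) := subsetP nT z gen_z.
have C1 : 'C_T[z] = 1.
  have := card_cent1_mod7 nTz; have := cardSg (subsetIl T 'C[z]); rewrite oT.
  rewrite dvdn_divisors // -[divisors 8]/[:: 1; 2; 4; 8]%N !inE.
  case/or4P=> /eqP oC; rewrite oC // => _; first by apply/card1_trivg.
  case/negP: normal8_not_cent; rewrite -sub_cent1; apply/setIidPl/eqP.
  by rewrite eqEcard subsetIl oT oC.
rewrite -trivg_Phi // trivg_card1.
have nPz : z \in 'N('Phi(T)) by rewrite (subsetP (char_norms (Phi_char T))).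
have := card_cent1_mod7 (N := 'Phi(T)%G) nPz.
have -> : 'C_('Phi(T))[z] = 1 by apply/trivgP; rewrite -C1 setSI // Phi_sub.
rewrite cards1.
have ntT : T :!=: 1 by rewrite -cardG_gt1 oT.
have := proper_card (Phi_proper ntT); have := cardSg (Phi_sub T); rewrite /= oT.
rewrite dvdn_divisors // -[divisors 8]/[:: 1; 2; 4; 8]%N !inE.
by case/or4P=> /eqP->.
Qed.

Lemma normal8_isog : T \isog [set: 'Z_2 * 'Z_2 * 'Z_2].
Proof.
rewrite (isog_abelem_card _ normal8_abelem) abelem_Z2cube oT.
by rewrite cardsT !card_prod !card_ord.
Qed.

(** G acts on T, seen as a space of dimension 3 over F_2, with kernel 'C_G(T), a
    proper normal subgroup containing T and so equal to T. *)
Lemma quotient8_isog_GL32 : G / T \isog 'GL_3(2).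
Proof.
have ntT : T :!=: 1 by rewrite -cardG_gt1 oT.
have nC : 'C_G(T) <| G by rewrite norm_normalI // norms_cent.
have sTC : T \subset 'C_G(T) by rewrite subsetI sTG; apply: abelem_abelian normal8_abelem.
have neC : 'C_G(T) != G.
  by apply: contra normal8_not_cent => /eqP e; have := gen_z; rewrite -e => /setIP[].
have C8 := proper_normal_eq8 nC neC.
have eC : 'C_G(T) = T.
  by apply/esym/eqP; rewrite eqEcard sTC oT C8 // -oT subset_leq_card.
apply: (faithful_quotient_GL32 (rG := abelem_repr normal8_abelem ntT nT)); last exact: oGT.
  by rewrite /abelem_dim' oT.
by rewrite rker_abelem.
Qed.

(** A complement has index 8, so it contains a normal subgroup of G of order 8;
    with T this would generate a normal subgroup of order 64. *)
Lemma normal8_nonsplit : ~~ [splits G, over T].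
Proof.
apply/splitsP => -[C /complP[tiTC defG]].
have sCG : C \subset G by rewrite -defG mulG_subr.
have iC : #|G : C| = 8.
  rewrite -divgS // -defG TI_cardMg // mulnK //.
have K8 := index8_gcore sCG iC.
have nK := gcore_normal sCG; have sKC := gcore_sub C G.
have tiTK : T :&: gcore C G = 1 by apply/trivgP; rewrite -tiTC setIS.
have nTK : T <*> gcore C G <| G by rewrite normalY.
have oTK : #|T <*> gcore C G| = (8 * #|gcore C G|)%N.
  by rewrite norm_joinEr ?(subset_trans (normal_sub nK)) // TI_cardMg // oT.
have oK : #|gcore C G| = 8.
  apply: (@proper_normal_eq8 [group of gcore C G]) => //.
  apply: contraTneq sKC => /= ->; apply/negP => /subset_leq_card.
  by rewrite -(leq_pmul2r (isT : 0 < 8)%N) -iC Lagrange // iC oG.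
have := @proper_normal_dvd32 [group of T <*> gcore C G] nTK.
rewrite /= oTK oK => H; suff: 64 %| 32 by [].
by apply: H; apply/eqP=> /(congr1 (fun A : {set gT} => #|A|)); rewrite oTK oK oG.
Qed.

End Order1344.

(** AGL_3(2) is transitive and faithful on the 8 vectors, while quotients of the
    triangle group induce groups of order at most 168 on 8 points. *)
Lemma AGL32_not_triangle (y z : {perm 'cV['F_2]_3}) :
  triangle_gens (AGL 3 'F_2) y z -> #|AGL 3 'F_2| = 1344 -> False.
Proof.
move=> tri oA.
have tr : [transitive AGL 3 'F_2, on [set: 'cV['F_2]_3] | 'P].
  apply/imsetP; exists 0%R => //; apply/esym/eqP; rewrite eqEsubset subsetT /=.
  apply/subsetP => b _; apply/orbitP.
  have injb : injective (fun v : 'cV['F_2]_3 => (v + b)%R) by apply: GRing.addIr.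
  exists (perm injb); last by rewrite /= apermE permE GRing.add0r.
  apply/AGLsetP; exists 1%:M%R, b; first exact: unitmx1.
  by move=> v; rewrite permE mul1mx.
have := triangle_degree8 tri tr; rewrite cardsT card_mx card_Fp // => /(_ erefl).
have -> : 'C_(AGL 3 'F_2)([set: 'cV['F_2]_3] | 'P) = 1.
  apply/trivgP/subsetP => s /setIP[_ /astabP fix_s]; rewrite inE; apply/eqP/permP => v.
  by rewrite perm1 -[RHS](fix_s v).
by rewrite indexg1 oA.
Qed.

Theorem mainTheorem1 (gT : finGroupType) (G : {group gT}) (hG : hurwitz_group 17 G) :
  (exists T : {group gT},
     [/\ T <| G,
         T \isog [set: 'Z_2 * 'Z_2 * 'Z_2],
         (G / T) \isog 'GL_3(2)
       & ~~ [splits G, over T]])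
  /\ ~~ (G \isog AGL 3 'F_2).
Proof.
have tri (hT : finGroupType) (H : {group hT}) : hurwitz_group 17 H ->
    #|H| = 1344 /\ exists y z, triangle_gens H y z.
  case/hurwitz_groupP => _ oH [x [y [z [defH x3 y2 z7 xyz]]]]; split=> //.
  have ex : x = (y * z)^-1 by apply/eqP; rewrite eq_mulgV1 invgK mulgA xyz.
  exists y, z; split=> //; last by rewrite -[y * z]invgK expgVn -ex x3 invg1.
  apply/eqP; rewrite -defH eqEsubset !gen_subG; apply/andP; split.
    by apply: subset_trans (subset_gen _); rewrite -setUA subsetUr.
  rewrite !subUset !sub1set ex groupV groupM ?mem_gen ?set21 ?set22 //.
have [oG [y [z triG]]] := tri _ _ hG; split.
  have [T nTG oT] := exists_normal8 triG oG; exists T; split=> //.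
  - exact: normal8_isog triG oG _ nTG oT.
  - exact: quotient8_isog_GL32 triG oG _ nTG oT.
  - exact: normal8_nonsplit triG oG _ nTG oT.
apply/negP => isoA.
have hA : hurwitz_group 17 (AGL 3 'F_2).
  by move: hG; rewrite /hurwitz_group (card_isog isoA) (eq_homGrp _ isoA).
by have [oA [y' [z' triA]]] := tri _ _ hA; apply: AGL32_not_triangle triA oA.
Qed.
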